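(* Let $A$ be a finite alphabet with $|A|\ge 2$. For every formula $\phi$ in the $\Sigma_2$ fragment of $\mathsf{FO}(A^*,\cdot)$ we can (effectively) construct a formula \[\psi=\exists x_1,\ldots,x_n.\ \forall y_1,\ldots,y_m.\ U\neq V,\] with $U,V\in (A\cup\{x_1,\ldots,x_n,y_1,\ldots,y_m\})^*$, such that $\phi$ holds in $A^*$ if and only if $\psi$ holds in $A^*$.
   Context: $A$ is an alphabet of constants (terminals), disjoint from the set of variables. A word equation is a formal equality $U=V$ where $U,V$ are words over constants and variables; a negated equation is $\lnot(U=V)$, also written $U\ne V$. Variables range over $A^*$; an assignment of words in $A^*$ to the variables is extended to a morphism fixing every letter of $A$, and it satisfies $U=V$ if the images of $U$ and $V$ coincide. A $\Sigma_2$ formula of $\mathsf{FO}(A^*,\cdot)$ is a sentence $\exists x_1,\ldots,x_n.\forall y_1,\ldots,y_\ell.\,\phi'$ with $\phi'$ a quantifier-free Boolean combination (using $\land,\lor,\lnot$) of word equations over $A\cup\{x_1,\ldots,x_n,y_1,\ldots,y_\ell\}$. The numbers and sets of variables in $\psi$ may differ from those in $\phi$. *)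

(* Defs.v *)
From mathcomp Require Import all_boot.

Set Implicit Arguments.
Unset Strict Implicit.
Unset Printing Implicit Defensive.

(* Sentences of the form  exists x_1 .. x_n, forall y_1 .. y_m, F  with F       *)
(* quantifier-free. Constants and the two blocks of variables are kept disjoint *)
(* by the constructors; n and m may be 0.                                       *)

Inductive symbol (A : finType) (n m : nat) : Type :=
  | Cst of A
  | ExVar of 'I_n
  | AllVar of 'I_m.

Definition word (A : finType) (n m : nat) : Type := seq (symbol A n m).

Inductive qf_formula (A : finType) (n m : nat) : Type :=
  | WEq of word A n m & word A n m
  | WAnd of qf_formula A n m & qf_formula A n m
  | WOr of qf_formula A n m & qf_formula A n m
  | WNot of qf_formula A n m.

Inductive sigma2 (A : finType) : Type :=
  | Sigma2 (n m : nat) of qf_formula A n m.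

Section Semantics.
Variables (A : finType) (n m : nat).
Variables (x : 'I_n -> seq A) (y : 'I_m -> seq A).

Definition symbol_val (s : symbol A n m) : seq A :=
  match s with
  | Cst a => [:: a]
  | ExVar i => x i
  | AllVar j => y j
  end.

Definition word_val (w : word A n m) : seq A := flatten (map symbol_val w).

Fixpoint sat (F : qf_formula A n m) : Prop :=
  match F with
  | WEq U V => word_val U = word_val V
  | WAnd F1 F2 => sat F1 /\ sat F2
  | WOr F1 F2 => sat F1 \/ sat F2
  | WNot F1 => ~ sat F1
  end.

End Semantics.

Definition holds (A : finType) (phi : sigma2 A) : Prop :=
  let: Sigma2 n m F := phi in
  exists x : 'I_n -> seq A, forall y : 'I_m -> seq A, sat x y F.

(* Effectivity: computability in the weak call-by-value lambda calculus (a      *)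
(* Turing-complete model), on Scott encodings of the syntax above. Classically, *)
(* a bare existence claim would be trivial: any true (resp. false) sentence     *)
(* would do. Variables are de Bruijn indices.                                   *)

Inductive term : Type :=
  | Var of nat
  | App of term & term
  | Lam of term.

Fixpoint bounded (k : nat) (s : term) : bool :=
  match s with
  | Var i => i < k
  | App s1 s2 => bounded k s1 && bounded k s2
  | Lam s1 => bounded k.+1 s1
  end.

Definition closed_term (s : term) : bool := bounded 0 s.

(* No lifting of u: evaluation of a closed term only substitutes closed terms.  *)
Fixpoint subst (s : term) (k : nat) (u : term) : term :=
  match s with
  | Var i => if i == k then u else Var i
  | App s1 s2 => App (subst s1 k u) (subst s2 k u)
  | Lam s1 => Lam (subst s1 k.+1 u)
  end.

Inductive evaluates : term -> term -> Prop :=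
  | eval_lam s : evaluates (Lam s) (Lam s)
  | eval_app s t s' t' v :
      evaluates s (Lam s') -> evaluates t t' ->
      evaluates (subst s' 0 t') v -> evaluates (App s t) v.

Definition computable (X Y : Type) (encX : X -> term) (encY : Y -> term)
    (f : X -> Y) : Prop :=
  exists t : term, closed_term t /\
    forall x : X, evaluates (App t (encX x)) (encY (f x)).

(* Scott encoding of the i-th (counted from 0) of k constructors, applied to    *)
(* closed arguments a_1 .. a_r:  \c_0 .. c_(k-1), c_i a_1 .. a_r.               *)
Definition scott (k i : nat) (args : seq term) : term :=
  iter k Lam (foldl App (Var (k - i.+1)) args).

Fixpoint enc_nat (n : nat) : term :=
  match n with
  | 0 => scott 2 0 [::]
  | n'.+1 => scott 2 1 [:: enc_nat n']
  end.

Fixpoint enc_seq (X : Type) (enc : X -> term) (s : seq X) : term :=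
  match s with
  | [::] => scott 2 0 [::]
  | x :: s' => scott 2 1 [:: enc x; enc_seq enc s']
  end.

Definition enc_symbol (A : finType) (n m : nat) (s : symbol A n m) : term :=
  match s with
  | Cst a => scott 3 0 [:: enc_nat (enum_rank a)]
  | ExVar i => scott 3 1 [:: enc_nat i]
  | AllVar j => scott 3 2 [:: enc_nat j]
  end.

Definition enc_word (A : finType) (n m : nat) (w : word A n m) : term :=
  enc_seq (@enc_symbol A n m) w.

Fixpoint enc_qf (A : finType) (n m : nat) (F : qf_formula A n m) : term :=
  match F with
  | WEq U V => scott 4 0 [:: enc_word U; enc_word V]
  | WAnd F1 F2 => scott 4 1 [:: enc_qf F1; enc_qf F2]
  | WOr F1 F2 => scott 4 2 [:: enc_qf F1; enc_qf F2]
  | WNot F1 => scott 4 3 [:: enc_qf F1]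
  end.

Definition enc_sigma2 (A : finType) (phi : sigma2 A) : term :=
  let: Sigma2 n m F := phi in
  scott 1 0 [:: enc_nat n; enc_nat m; enc_qf F].

(* Main.v *)
(* Negating the matrix, it suffices to write the negation of a quantifier-free  *)
(* formula as "exists z, U = V". Two equations are merged into one by           *)
(* interleaving them with two distinct letters. For the disjunction of X = Z    *)
(* and Y = W, the equations X p = q Z and Y p' = q' W with fresh variables are  *)
(* always solvable and give X = Z if pq is empty, Y = W if p'q' is empty; that  *)
(* one of pq, p'q' is empty is expressed by splitting the word ab as st and     *)
(* requiring s to commute with pq and a pq b, and t with p'q' and a p'q' b. An  *)
(* inequation is a finite disjunction over letters.                             *)
(* Each of these constructions is a fixed pattern of concatenations, which is   *)
(* compiled uniformly to the lambda calculus.                                   *)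

Require Import Defs.
From mathcomp Require Import all_boot.
From mathcomp Require Import zify.
From Stdlib Require Import Setoid.

Set Implicit Arguments.
Unset Strict Implicit.
Unset Printing Implicit Defensive.

(** * Conjunction and disjunction of word equations *)

(** Fix [x]. Then [F] fails for some [y] exactly when [~ F] is satisfiable in [y], so it suffices to
    turn [~ F] into one equation [U = V] over [x], [y] and fresh variables that is solvable in the
    fresh ones exactly when [F] fails at [x], [y]. Counting the fresh variables as universal,
    [forall y, F] then says that [U <> V] always.

    With negations pushed to the atoms, three operations on equations remain: conjunction
    ([pair_coding]), disjunction ([nil_or_nil] forces one of the two equations to hold) and
    inequality ([neq_clauseP], a finite disjunction). [tr_translates] composes them along the
    formula; each step takes its new variables above all those in use, so a solution is extended
    without disturbing what was already solved.

    For effectivity, each operation is a template depending only on [A], [a], [b]. [build_program]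
    compiles any template to a closed lambda term, and [tr_program] calls the four terms needed from
    a recursion over the formula. *)

Section WordCoding.
Variables (A : eqType) (a b : A).
Hypothesis ab : a != b.
Implicit Types U V s t p q : seq A.

(** If [U] ended before [V] or conversely, the next letter of the longer one would have to be both
    [a] and [b]. *)
Lemma eq_cat_of_two_letters U V U' V' :
    U ++ a :: U' = V ++ a :: V' -> U ++ b :: U' = V ++ b :: V' ->
  U = V /\ U' = V'.
Proof.
elim: U V => [|c U IH] [|d V] /=.
- by move=> [->].
- by move=> [eqa _] [eqb _]; have := ab; rewrite eqa eqb eqxx.
- by move=> [eqa _] [eqb _]; have := ab; rewrite -eqa -eqb eqxx.
- by move=> [-> eqa] [eqb]; case: (IH _ eqa eqb) => -> ->.
Qed.

(** The two halves of each side have the same length, so both sides are cut at the same place, and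
    the halves give the two hypotheses of [eq_cat_of_two_letters]. *)
Lemma pair_coding U V U' V' :
  U ++ a :: U' ++ U ++ b :: U' = V ++ a :: V' ++ V ++ b :: V' <->
  U = V /\ U' = V'.
Proof.
split=> [eqUV|[-> ->] //].
have szE : size (U ++ a :: U') = size (V ++ a :: V').
  by move/(congr1 size): eqUV; do !rewrite !size_cat /=; lia.
have /eqP := eqUV; rewrite -!cat_cons !catA -(catA (U ++ _)) -(catA (V ++ _)).
rewrite eqseq_cat // => /andP[/eqP + /eqP].
exact: eq_cat_of_two_letters.
Qed.

(** A first letter of [p] would be [a] by the first equation, and [b] by the second, where the added
    [a] moves it under the second letter of [ab]. *)
Lemma commute_ab_nil p :
    [:: a; b] ++ p = p ++ [:: a; b] ->
    [:: a; b] ++ a :: p ++ [:: b] = (a :: p ++ [:: b]) ++ [:: a; b] ->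
  p = [::].
Proof.
case: p => // c p /= [eqa _] [eqb _].
by have := ab; rewrite eqa eqb eqxx.
Qed.

Lemma commute_a_absurd p :
  [:: a] ++ a :: p ++ [:: b] <> (a :: p ++ [:: b]) ++ [:: a].
Proof.
move/(congr1 (last a)); rewrite /= !last_cat /= => eqb.
by have := ab; rewrite eqb eqxx.
Qed.

(* A splitting st = ab is forced to be trivial by the commutations, and then   *)
(* the nonempty one of s, t forces its partner p or q to be empty.             *)
Lemma nil_or_nil s t p q :
    s ++ t = [:: a; b] ->
    s ++ p = p ++ s -> s ++ a :: p ++ [:: b] = (a :: p ++ [:: b]) ++ s ->
    t ++ q = q ++ t -> t ++ a :: q ++ [:: b] = (a :: q ++ [:: b]) ++ t ->
  p = [::] \/ q = [::].
Proof.
case: s => [/= -> _ _|c [|d [|e s]]].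
- by move=> *; right; apply: commute_ab_nil.
- by move=> [-> _] _ /commute_a_absurd.
- by move=> [-> -> _] *; left; apply: commute_ab_nil.
- by [].
Qed.

End WordCoding.

(** * Templates of equations *)

(* [TParam i] is a placeholder for a word, [TFresh k] for the k-th fresh        *)
(* variable; the placeholders have to be filled by words computed later.        *)
Inductive tatom (A : Type) : Type :=
  | TParam of nat
  | TLetter of A
  | TFresh of nat.
Arguments TParam {A} _.
Arguments TFresh {A} _.

Definition template A := seq (tatom A).
Definition tequation A := (template A * template A)%type.

Section TemplateSemantics.
Variable A : finType.
Implicit Types (ps : seq (seq A)) (z : nat -> seq A) (e f : tequation A).

Definition tatom_val ps z (s : tatom A) : seq A :=
  match s with
  | TParam i => nth [::] ps i
  | TLetter c => [:: c]
  | TFresh k => z k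
  end.

Definition tval ps z (L : template A) := flatten (map (tatom_val ps z) L).
Definition tholds ps z e := tval ps z e.1 = tval ps z e.2.

Definition tatom_below k (s : tatom A) : bool :=
  if s is TFresh i then i < k else true.
Definition tbelow k e := all (tatom_below k) e.1 && all (tatom_below k) e.2.

Lemma tval_cat ps z L M : tval ps z (L ++ M) = tval ps z L ++ tval ps z M.
Proof. by rewrite /tval map_cat flatten_cat. Qed.

Lemma tval_cons ps z s L : tval ps z (s :: L) = tatom_val ps z s ++ tval ps z L.
Proof. by []. Qed.

Lemma tval_nil ps z : tval ps z [::] = [::].
Proof. by []. Qed.

Definition tvalE := (tval_cat, tval_cons, tval_nil, cats0).

Lemma tval_below k ps z z' L :
    (forall i, i < k -> z i = z' i) -> all (tatom_below k) L ->
  tval ps z L = tval ps z' L.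
Proof.
move=> eqz; elim: L => //= s L IH /andP[sk Lk]; rewrite !tval_cons IH //.
by case: s sk => //= i /eqz ->.
Qed.

Lemma tholds_below k ps z z' e :
    (forall i, i < k -> z i = z' i) -> tbelow k e ->
  tholds ps z e <-> tholds ps z' e.
Proof.
move=> eqz /andP[k1 k2].
by rewrite /tholds (tval_below _ eqz k1) (tval_below _ eqz k2).
Qed.

Lemma tbelow_leq k l e : k <= l -> tbelow k e -> tbelow l e.
Proof.
move=> kl /andP[k1 k2]; apply/andP; split; [move: k1 | move: k2];
  by apply: sub_all => -[] //= i /leq_trans; apply.
Qed.

Variables (a b : A).
Hypothesis ab : a != b.

Definition tconj e f : tequation A :=
  let pair L M := L ++ TLetter a :: M ++ L ++ TLetter b :: M in
  (pair e.1 f.1, pair e.2 f.2).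

Lemma tholds_conj ps z e f :
  tholds ps z (tconj e f) <-> tholds ps z e /\ tholds ps z f.
Proof. by rewrite /tholds /tconj !tvalE; apply: pair_coding. Qed.

Lemma tbelow_conj k e f : tbelow k e -> tbelow k f -> tbelow k (tconj e f).
Proof.
move=> /andP[e1 e2] /andP[f1 f2].
by rewrite /tbelow /tconj; do !rewrite /= ?all_cat ?e1 ?e2 ?f1 ?f2.
Qed.

Definition tcommute (L M : template A) : tequation A := (L ++ M, M ++ L).

(* The equations e.1 p = q e.2 and f.1 p' = q' f.2 are always solvable, by      *)
(* p = e.2, q = e.1 and so on; they say e (resp. f) when pq (resp. p'q') is     *)
(* empty, which the remaining equations require of one of pq and p'q'.          *)
Definition tdisj k e f : tequation A :=
  let v i : template A := [:: TFresh (k + i)] in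
  let s := v 0 in let t := v 1 in
  let p := v 2 in let q := v 3 in let p' := v 4 in let q' := v 5 in
  let enclose L := TLetter a :: L ++ [:: TLetter b] in
  tconj (s ++ t, [:: TLetter a; TLetter b])
 (tconj (tcommute s (p ++ q))
 (tconj (tcommute s (enclose (p ++ q)))
 (tconj (tcommute t (p' ++ q'))
 (tconj (tcommute t (enclose (p' ++ q')))
 (tconj (e.1 ++ p, q ++ e.2) (f.1 ++ p', q' ++ f.2)))))).

Lemma tholds_disj ps z k e f :
  tholds ps z (tdisj k e f) -> tholds ps z e \/ tholds ps z f.
Proof.
rewrite /tdisj !tholds_conj /tholds /tcommute !(tvalE, =^~ cat_cons, =^~ catA).
rewrite /tatom_val /= => -[st [sp [sapb [tq [taqb [eqe eqf]]]]]].
have [] := nil_or_nil (p := z (k + 2) ++ z (k + 3))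
                      (q := z (k + 4) ++ z (k + 5)) ab st.
- by rewrite -catA.
- by rewrite -!catA /= -!catA.
- by rewrite -catA.
- by rewrite -!catA /= -!catA.
- move=> nil; left; move: eqe.
  by case: (z (k + 2)) nil => [|//] /= ->; rewrite cats0.
- move=> nil; right; move: eqf.
  by case: (z (k + 4)) nil => [|//] /= ->; rewrite cats0.
Qed.

Lemma tholds_disj_ex ps z k e f :
    tbelow k e -> tbelow k f -> tholds ps z e \/ tholds ps z f ->
  exists2 z', forall i, i < k -> z i = z' i & tholds ps z' (tdisj k e f).
Proof.
move=> ek fk ef.
(* Values of s, t, p, q, p', q' in this order. The equation that holds gets an empty pair and the
   whole word [ab] to commute with; the other gets the solution that always exists and the empty
   word. *)
pose w := if tval ps z e.1 == tval ps z e.2 then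
    [:: [:: a; b]; [::]; [::]; [::]; tval ps z f.2; tval ps z f.1]
  else [:: [::]; [:: a; b]; tval ps z e.2; tval ps z e.1; [::]; [::]].
pose z' i := if i < k then z i else nth [::] w (i - k).
have eqz i : i < k -> z i = z' i by rewrite /z' => ->.
have zw i : z' (k + i) = nth [::] w i by rewrite /z' ltnNge leq_addr /= addKn.
exists z' => //.
have /andP[e1 e2] := ek; have /andP[f1 f2] := fk.
rewrite /tdisj !tholds_conj /tholds /tcommute !(tvalE, =^~ cat_cons, =^~ catA).
rewrite -!(tval_below _ eqz) // /tatom_val !zw /w.
case: eqP => [eqe|neqe] /=; rewrite ?cats0; first by rewrite eqe.
by case: ef => [/neqe//|->]; rewrite ?cats0.
Qed.

Lemma tbelow_disj k e f :
  tbelow k e -> tbelow k f -> tbelow (k + 6) (tdisj k e f).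
Proof.
move=> /(tbelow_leq (leq_addr 6 k)) /andP[e1 e2].
move=> /(tbelow_leq (leq_addr 6 k)) /andP[f1 f2].
rewrite /tdisj; do !apply: tbelow_conj;
  by rewrite /tbelow /= ?all_cat ?e1 ?e2 ?f1 ?f2 /= ?ltn_add2l.
Qed.

(** The empty disjunction is the unsolvable equation between [a] and the empty word. The disjuncts
    may share the variables below [k], as only one of them has to hold; the number returned is the
    next free index. *)
Fixpoint tdisjs (I : Type) (F : I -> tequation A) k (r : seq I) :
    nat * tequation A :=
  if r is i :: r' then
    let: (l, f) := tdisjs F k r' in (l + 6, tdisj l (F i) f)
  else (k, ([:: TLetter a], [::])).

Lemma tbelow_disjs (I : Type) (F : I -> tequation A) k r :
    (forall i, tbelow k (F i)) ->
  k <= (tdisjs F k r).1 /\ tbelow (tdisjs F k r).1 (tdisjs F k r).2.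
Proof.
move=> Fk; elim: r => //= i r; case: tdisjs => l f /= [kl fl].
split; first exact: leq_trans kl (leq_addr _ _).
exact/tbelow_disj/fl/tbelow_leq/Fk.
Qed.

Lemma tholds_disjs (I : eqType) (F : I -> tequation A) ps z k r :
    tholds ps z (tdisjs F k r).2 ->
  exists2 i, i \in r & tholds ps z (F i).
Proof.
elim: r => //= i r IH; case: tdisjs IH => l f /= IH.
case/tholds_disj=> [hi|/IH[j jr hj]]; first by exists i; rewrite ?mem_head.
by exists j; rewrite ?inE ?jr ?orbT.
Qed.

Lemma tholds_disjs_ex (I : eqType) (F : I -> tequation A) ps z k r i :
    (forall i, tbelow k (F i)) -> i \in r -> tholds ps z (F i) ->
  exists2 z', forall j, j < k -> z j = z' j & tholds ps z' (tdisjs F k r).2.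
Proof.
move=> Fk; elim: r => //= j r IH.
have [+ +] := tbelow_disjs r Fk; case: tdisjs IH => l f /= IH kl fl.
have Fl := tbelow_leq kl (Fk j).
rewrite inE => /orP[/eqP ->|/IH {}IH] hi.
  have [z' eqz hz'] := tholds_disj_ex Fl fl (or_introl hi).
  by exists z' => // k' lt_k'; apply/eqz/leq_trans/kl.
have [z1 eqz1 hz1] := IH hi.
have [z2 eqz2 hz2] := tholds_disj_ex Fl fl (or_intror hz1).
by exists z2 => // k' lt_k'; rewrite eqz1 // eqz2 //; apply: leq_trans kl.
Qed.

(** * Templates for the logical connectives *)

(* A template over four parameters with its number of fresh variables.          *)
Definition gadget := (nat * tequation A)%type.

Definition gadget_spec (g : gadget)
    (P : seq A -> seq A -> seq A -> seq A -> Prop) :=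
  tbelow g.1 g.2 /\
  forall U V U' V', (exists z, tholds [:: U; V; U'; V'] z g.2) <-> P U V U' V'.

Definition gatom : gadget := (0, ([:: TParam 0], [:: TParam 1])).

Definition gconj : gadget :=
  (0, tconj ([:: TParam 0], [:: TParam 1]) ([:: TParam 2], [:: TParam 3])).

Definition gdisj : gadget :=
  (6, tdisj 0 ([:: TParam 0], [:: TParam 1]) ([:: TParam 2], [:: TParam 3])).

(** Two words differ if after a common prefix, [TFresh 0], they continue with distinct letters, or
    if one is a proper prefix of the other. The diagonal pairs get an unsolvable equation, so that
    the index type is a plain sum. *)
Definition neq_clause (i : (A * A) + (bool * A)) : tequation A :=
  match i with
  | inl (c, d) =>
      if c == d then ([:: TLetter c], [::])
      else tconj ([:: TParam 0], [:: TFresh 0; TLetter c; TFresh 1])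
                 ([:: TParam 1], [:: TFresh 0; TLetter d; TFresh 2])
  | inr (true, c) => ([:: TParam 0], [:: TParam 1; TLetter c; TFresh 0])
  | inr (false, c) => ([:: TParam 1], [:: TParam 0; TLetter c; TFresh 0])
  end.

Definition gneq : gadget := tdisjs neq_clause 3 (enum {: (A * A) + (bool * A)}).

Lemma gatom_spec : gadget_spec gatom (fun U V _ _ => U = V).
Proof.
split=> // U V U' V'; rewrite /tholds /tval /= ?cats0.
by split=> [[] //|eqUV]; exists (fun=> [::]).
Qed.

Lemma gconj_spec : gadget_spec gconj (fun U V U' V' => U = V /\ U' = V').
Proof.
split=> [|U V U' V']; first exact: tbelow_conj.
split=> [[z]|eqs]; last exists (fun=> [::]);
  by rewrite tholds_conj /tholds /tval /= ?cats0.
Qed.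

Lemma gdisj_spec : gadget_spec gdisj (fun U V U' V' => U = V \/ U' = V').
Proof.
split=> [|U V U' V']; first exact: (@tbelow_disj 0).
split=> [[z /tholds_disj]|eqs]; first by rewrite /tholds /tval /= ?cats0.
have [|||z' _ hz'] := @tholds_disj_ex [:: U; V; U'; V'] (fun=> [::]) 0
  ([:: TParam 0], [:: TParam 1]) ([:: TParam 2], [:: TParam 3]) => //.
- by rewrite /tholds /tval /= ?cats0.
- by exists z'.
Qed.

Lemma neq_clauseP U V U' V' :
  (exists i z, tholds [:: U; V; U'; V'] z (neq_clause i)) <-> U <> V.
Proof.
split=> [[[[c d]|[[] c]] [z]] /=|].
- case: eqP => // neqcd; rewrite tholds_conj /tholds /tval /= ?cats0.
  case=> -> ->.
  by move/(congr1 (drop (size (z 0)))); rewrite !drop_size_cat // => -[].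
- rewrite /tholds /tval /= ?cats0 => -> /(congr1 size).
  by rewrite size_cat /=; lia.
- rewrite /tholds /tval /= ?cats0 => -> /(congr1 size).
  by rewrite size_cat /=; lia.
elim: U V => [|c U IH] [|d V] //.
- by exists (inr (false, d)), (fun=> V); rewrite /tholds /tval /= ?cats0.
- by exists (inr (true, c)), (fun=> U); rewrite /tholds /tval /= ?cats0.
have [<-|neqcd] := eqVneq c d; last first.
  move=> _; exists (inl (c, d)), (nth [::] [:: [::]; U; V]).
  by rewrite /neq_clause (negPf neqcd) tholds_conj /tholds /tval /= ?cats0.
move=> neqUV; have /IH[i [z]] : U <> V.
  by move=> eqUV; case: neqUV; rewrite eqUV.
case: i => [[c' d']|[b' c']].
  move=> /=; case: eqVneq => // neq /tholds_conj[eqU eqV].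
  rewrite /tholds /tval /= ?cats0 in eqU eqV.
  (* The common first letter joins the common prefix. *)
  exists (inl (c', d')), (nth [::] [:: c :: z 0; z 1; z 2]).
  rewrite /neq_clause (negPf neq) tholds_conj /tholds /tval /= ?cats0.
  by rewrite eqU eqV.
move=> h; exists (inr (b', c')), z.
by case: b' h; rewrite /tholds /tval /= ?cats0 => ->.
Qed.

Lemma tbelow_neq_clause i : tbelow 3 (neq_clause i).
Proof.
by case: i => [[c d]|[[] c]] //=; case: eqP => // _; apply: tbelow_conj.
Qed.

Lemma gneq_spec : gadget_spec gneq (fun U V _ _ => U <> V).
Proof.
split=> [|U V U' V']; first exact: (tbelow_disjs _ tbelow_neq_clause).2.
rewrite -(neq_clauseP U V U' V').
split=> [[z /tholds_disjs[i _ hi]]|[i [z hz]]]; first by exists i, z.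
have iE : i \in enum {: (A * A) + (bool * A)} by rewrite mem_enum.
by have [z' _ hz'] := tholds_disjs_ex tbelow_neq_clause iE hz; exists z'.
Qed.

End TemplateSemantics.

(** * Translation of a quantifier-free formula into one equation *)

(* Symbols whose variable indices are not bounded by their type: the encodings  *)
(* ignore these bounds, and the number of variables grows during translation.   *)
Inductive rsym (A : Type) : Type :=
  | RCst of A
  | REx of nat
  | RAll of nat.
Arguments REx {A} _.
Arguments RAll {A} _.

Section Translation.
Variable A : finType.
Implicit Types (x y : nat -> seq A) (L : template A) (w : seq (rsym A)).

Definition rsym_val x y (s : rsym A) : seq A :=
  match s with
  | RCst c => [:: c]
  | REx i => x i
  | RAll j => y j
  end.
Definition rval x y w := flatten (map (rsym_val x y) w).

Definition rsym_below n m (s : rsym A) : bool :=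
  match s with
  | RCst _ => true
  | REx i => i < n
  | RAll j => j < m
  end.

Definition raw n m (s : symbol A n m) : rsym A :=
  match s with
  | Cst c => RCst c
  | ExVar i => REx i
  | AllVar j => RAll j
  end.

(** The letter [c0] is a default for indices out of range, which [rsym_below] excludes. *)
Definition unraw (c0 : A) n m (s : rsym A) : symbol A n m :=
  match s with
  | RCst c => Cst n m c
  | REx i => oapp (@ExVar A n m) (Cst n m c0) (insub i)
  | RAll j => oapp (@AllVar A n m) (Cst n m c0) (insub j)
  end.

Lemma unrawK c0 n m w :
  all (rsym_below n m) w -> map (@raw n m) (map (unraw c0 n m) w) = w.
Proof.
elim: w => //= s w IH /andP[sb /IH ->]; congr (_ :: _).
by case: s sb => //= i ib; rewrite insubT.
Qed.

Lemma raw_below n m (w : word A n m) : all (rsym_below n m) (map (@raw n m) w).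
Proof. by elim: w => //= s w ->; case: s => //= i; rewrite ltn_ord. Qed.

Lemma rval_raw x y n m (w : word A n m) :
  rval x y (map (@raw n m) w) = word_val (x \o val) (y \o val) w.
Proof.
by elim: w => //= s w IH; rewrite /rval /word_val /= -/(rval x y _) IH; case: s.
Qed.

Lemma rval_below n m x y y' w :
    (forall j, j < m -> y j = y' j) -> all (rsym_below n m) w ->
  rval x y w = rval x y' w.
Proof.
move=> eqy; elim: w => //= s w IH /andP[sb wb]; rewrite /rval /=.
by rewrite -/(rval x y w) IH //; case: s sb => //= j /eqy ->.
Qed.

Lemma rsym_below_leq n m m' w :
  m <= m' -> all (rsym_below n m) w -> all (rsym_below n m') w.
Proof. by move=> mm'; apply: sub_all => -[] //= j /leq_trans; apply. Qed.

(* Variables from m on are the unused ones.                                     *)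
Definition fill (ws : seq (seq (rsym A))) m (s : tatom A) : seq (rsym A) :=
  match s with
  | TParam i => nth [::] ws i
  | TLetter c => [:: RCst c]
  | TFresh k => [:: RAll (m + k)]
  end.
Definition instance ws m L := flatten (map (fill ws m) L).

Lemma rval_cat x y w w' : rval x y (w ++ w') = rval x y w ++ rval x y w'.
Proof. by rewrite /rval map_cat flatten_cat. Qed.

Lemma rval_instance x y ws m L :
  rval x y (instance ws m L) =
    tval (map (rval x y) ws) (fun k => y (m + k)) L.
Proof.
elim: L => //= s L IH; rewrite /instance /= rval_cat -/(instance _ _ _) IH.
rewrite tval_cons; congr (_ ++ _).
case: s => //= i; last by rewrite /rval /= cats0.
by elim: ws {IH} i => [|w ws IH] [] //=; rewrite IH.
Qed.

Lemma instance_below n m ws k L :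
    all (all (rsym_below n m)) ws -> all (tatom_below k) L ->
  all (rsym_below n (m + k)) (instance ws m L).
Proof.
move=> wsb; elim: L => //= s L IH /andP[sk /IH Lb].
rewrite /instance /= all_cat -/(instance _ _ _) Lb andbT.
case: s sk => //= [i _|j jk]; last by rewrite ltn_add2l jk.
have [ile|ilt] := leqP (size ws) i; first by rewrite nth_default.
by apply: rsym_below_leq (leq_addr _ _) _; exact: all_nthP wsb i ilt.
Qed.

Definition requation := (nat * seq (rsym A) * seq (rsym A))%type.
Implicit Type E : requation.

Definition rholds x y E := rval x y E.1.2 = rval x y E.2.
Definition rbelow n E :=
  all (rsym_below n E.1.1) E.1.2 && all (rsym_below n E.1.1) E.2.

Definition build (g : gadget A) U V U' V' m : requation :=
  let ws := [:: U; V; U'; V'] in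
  (m + g.1, instance ws m g.2.1, instance ws m g.2.2).

Lemma build_below g P n U V U' V' m :
    gadget_spec g P -> all (all (rsym_below n m)) [:: U; V; U'; V'] ->
  rbelow n (build g U V U' V' m).
Proof.
by move=> [/andP[g1 g2] _] wsb; rewrite /rbelow /= !instance_below.
Qed.

Lemma build_sound g P x y U V U' V' m :
    gadget_spec g P -> rholds x y (build g U V U' V' m) ->
  P (rval x y U) (rval x y V) (rval x y U') (rval x y V').
Proof.
move=> [_ gP]; rewrite /rholds /= !rval_instance => h.
by apply/gP; exists (fun k => y (m + k)).
Qed.

Lemma build_complete g P n x y U V U' V' m :
    gadget_spec g P -> all (all (rsym_below n m)) [:: U; V; U'; V'] ->
    P (rval x y U) (rval x y V) (rval x y U') (rval x y V') ->
  exists2 y', forall j, j < m -> y j = y' j &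
    rholds x y' (build g U V U' V' m).
Proof.
move=> [gb gP] wsb /gP[z hz].
pose y' j := if j < m then y j else z (j - m).
have eqy j : j < m -> y j = y' j by rewrite /y' => ->.
exists y' => //; rewrite /rholds /= !rval_instance /=.
have eqr w : all (rsym_below n m) w -> rval x y' w = rval x y w.
  by move=> wb; symmetry; apply: rval_below wb.
case/and5P: wsb => ? ? ? ? _; rewrite !eqr //.
have eqz k : k < g.1 -> z k = y' (m + k).
  by move=> _; rewrite /y' ltnNge leq_addr addKn.
exact: (tholds_below _ eqz gb).1 hz.
Qed.

(* E has a solution extending y exactly when P holds, where only variables     *)
(* below m count as variables of P, and the variables of E are below E.1.1.    *)
Definition translates n m E (P : (nat -> seq A) -> (nat -> seq A) -> Prop) :=
  [/\ m <= E.1.1, rbelow n E, forall x y, rholds x y E -> P x y &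
    forall x y, P x y ->
      exists2 y', forall j, j < m -> y j = y' j & rholds x y' E].

Definition depends_below m (P : (nat -> seq A) -> (nat -> seq A) -> Prop) :=
  forall x y y', (forall j, j < m -> y j = y' j) -> P x y -> P x y'.

Lemma translates_iff n m E P Q :
  (forall x y, P x y <-> Q x y) -> translates n m E P -> translates n m E Q.
Proof.
move=> PQ [mE Eb EP PE]; split=> // x y; first by move/EP/PQ.
by move/PQ/PE.
Qed.

Lemma rholds_below n x y y' E :
    (forall j, j < E.1.1 -> y j = y' j) -> rbelow n E ->
  rholds x y E -> rholds x y' E.
Proof.
move=> eqy /andP[Ub Vb]; rewrite /rholds.
by rewrite (rval_below _ eqy Ub) (rval_below _ eqy Vb).
Qed.

Lemma translates_build2 g n m E1 E2 (P1 P2 : _ -> _ -> Prop) Q :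
    gadget_spec g Q ->
    translates n m E1 P1 -> translates n E1.1.1 E2 P2 ->
  m <= E2.1.1 + g.1 /\ rbelow n (build g E1.1.2 E1.2 E2.1.2 E2.2 E2.1.1).
Proof.
move=> gQ [m1 /andP[b1 b1'] _ _] [m2 /andP[b2 b2'] _ _]; split.
  exact: leq_trans (leq_trans m1 m2) (leq_addr _ _).
by apply: build_below gQ _; rewrite /= b2 b2' !(rsym_below_leq m2).
Qed.

Variables (a b : A).
Hypothesis ab : a != b.

(** Solving [E1] changes [y] only from [m] on, where [P2] does not look; solving [E2] then changes
    it only from [E1.1.1] on, where [E1] has no variables. *)
Lemma translates_conj n m E1 E2 P1 P2 :
    depends_below m P2 ->
    translates n m E1 P1 -> translates n E1.1.1 E2 P2 ->
  translates n m (build (gconj a b) E1.1.2 E1.2 E2.1.2 E2.2 E2.1.1)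
    (fun x y => P1 x y /\ P2 x y).
Proof.
move=> dP2 t1 t2; have [mE Eb] := translates_build2 (gconj_spec ab) t1 t2.
case: t1 t2 => [m1 b1 s1 c1] [m2 b2 s2 c2]; split=> // x y.
  by move/(build_sound (gconj_spec ab)) => [/s1 ? /s2].
case=> /c1[y1 eqy1 h1] /(dP2 _ _ _ eqy1)/c2[y2 eqy2 h2].
have h1' := rholds_below eqy2 b1 h1.
have wsb : all (all (rsym_below n E2.1.1)) [:: E1.1.2; E1.2; E2.1.2; E2.2].
  case/andP: b1 b2 => b1 b1' /andP[b2 b2'].
  by rewrite /= b2 b2' !(rsym_below_leq m2).
have [y3 eqy3 h3] := build_complete (gconj_spec ab) wsb (conj h1' h2).
by exists y3 => // j jm; rewrite eqy1 // eqy2 ?eqy3 //; lia.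
Qed.

Lemma translates_disj n m E1 E2 P1 P2 :
    depends_below m P2 ->
    translates n m E1 P1 -> translates n E1.1.1 E2 P2 ->
  translates n m (build (gdisj a b) E1.1.2 E1.2 E2.1.2 E2.2 E2.1.1)
    (fun x y => P1 x y \/ P2 x y).
Proof.
move=> dP2 t1 t2; have [mE Eb] := translates_build2 (gdisj_spec ab) t1 t2.
case: t1 t2 => [m1 b1 s1 c1] [m2 b2 s2 c2]; split=> // x y.
  by move/(build_sound (gdisj_spec ab)) => [/s1|/s2]; [left | right].
move=> P12; have [y1 eqy1 h12] : exists2 y', forall j, j < m -> y j = y' j &
    rholds x y' E1 \/ rholds x y' E2.
  case: P12 => [/c1[y1 eqy h]|/c2[y2 eqy h]].
    by exists y1 => //; left.
  by exists y2 => [j jm|]; [apply: eqy; lia | right].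
have wsb : all (all (rsym_below n E2.1.1)) [:: E1.1.2; E1.2; E2.1.2; E2.2].
  case/andP: b1 b2 => b1 b1' /andP[b2 b2'].
  by rewrite /= b2 b2' !(rsym_below_leq m2).
have [y3 eqy3 h3] := build_complete (gdisj_spec ab) wsb h12.
by exists y3 => // j jm; rewrite eqy1 // eqy3 //; lia.
Qed.

(** [pos] is the polarity: an equation can state that a solution exists but not that none does, so
    negations are pushed to the atoms by De Morgan. *)
Fixpoint tr n m0 (F : qf_formula A n m0) (pos : bool) (m : nat) : requation :=
  match F with
  | WEq U V =>
      let U := map (@raw n m0) U in let V := map (@raw n m0) V in
      build (if pos then gatom A else gneq a b) U V U V m
  | WAnd F1 F2 =>
      let: (m1, U1, V1) := tr F1 pos m in
      let: (m2, U2, V2) := tr F2 pos m1 in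
      build (if pos then gconj a b else gdisj a b) U1 V1 U2 V2 m2
  | WOr F1 F2 =>
      let: (m1, U1, V1) := tr F1 pos m in
      let: (m2, U2, V2) := tr F2 pos m1 in
      build (if pos then gdisj a b else gconj a b) U1 V1 U2 V2 m2
  | WNot F1 => tr F1 (~~ pos) m
  end.

(** Decidable equality of words provides, without axioms, the classical steps behind De Morgan and
    double negation. *)
Lemma sat_dec n m (x : 'I_n -> seq A) (y : 'I_m -> seq A) F :
  sat x y F \/ ~ sat x y F.
Proof.
elim: F => [U V|F1 + F2|F1 + F2|F1] /=; try tauto.
by case: (word_val x y U =P word_val x y V); [left | right].
Qed.

Lemma word_val_ext n m (x x' : 'I_n -> seq A) (y y' : 'I_m -> seq A)
    (w : word A n m) :
  x =1 x' -> y =1 y' -> word_val x y w = word_val x' y' w.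
Proof.
by move=> eqx eqy; congr flatten; apply: eq_map => -[c|i|j] /=.
Qed.

Lemma sat_ext n m (x x' : 'I_n -> seq A) (y y' : 'I_m -> seq A) F :
  x =1 x' -> y =1 y' -> sat x y F <-> sat x' y' F.
Proof.
move=> eqx eqy; elim: F => [U V|F1 + F2|F1 + F2|F1] /=; try tauto.
by rewrite !(word_val_ext _ eqx eqy).
Qed.

Definition polar n m (F : qf_formula A n m) pos x y : Prop :=
  let P := sat (x \o @nat_of_ord n) (y \o @nat_of_ord m) F in
  if pos then P else ~ P.

Lemma polar_depends n m0 m (F : qf_formula A n m0) pos :
  m0 <= m -> depends_below m (polar F pos).
Proof.
move=> m0m x y y' eqy; rewrite /polar.
have eqy0 : y \o @nat_of_ord m0 =1 y' \o @nat_of_ord m0.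
  by move=> j; apply/eqy/leq_trans/m0m.
by case: pos; rewrite (sat_ext F (fun=> erefl) eqy0).
Qed.

Lemma tr_translates n m0 (F : qf_formula A n m0) pos m :
  m0 <= m -> translates n m (tr F pos m) (polar F pos).
Proof.
have dec G x y := @sat_dec n m0 (x \o @nat_of_ord n) (y \o @nat_of_ord m0) G.
elim: F pos m => [U V|F1 IH1 F2 IH2|F1 IH1 F2 IH2|F1 IH1] pos m m0m /=.
- pose U' := map (@raw n m0) U; pose V' := map (@raw n m0) V.
  have wsb : all (all (rsym_below n m)) [:: U'; V'; U'; V'].
    by rewrite /= !(rsym_below_leq m0m (raw_below _)).
  rewrite /polar; case: pos; split=> [||x y|x y]; rewrite ?leq_addr //.
  + exact: build_below (gatom_spec A) wsb.
  + by move/(build_sound (gatom_spec A)); rewrite !rval_raw.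
  + move=> eqUV; apply: build_complete (gatom_spec A) wsb _.
    by rewrite !rval_raw.
  + exact: build_below (gneq_spec ab) wsb.
  + by move/(build_sound (gneq_spec ab)); rewrite !rval_raw.
  + move=> eqUV; apply: build_complete (gneq_spec ab) wsb _.
    by rewrite !rval_raw.
1,2: have t1 := IH1 pos m m0m; case: (tr F1 pos m) t1 => [[m1 U1] V1] t1;
  have m1m : m0 <= m1 by case: t1 => /= mm1 _ _ _; apply: leq_trans mm1.
1,2: have t2 := IH2 pos m1 m1m; case: (tr F2 pos m1) t2 => [[m2 U2] V2] t2;
  have dP2 := @polar_depends n m0 m F2 pos m0m;
  have tc := translates_conj dP2 t1 t2; have td := translates_disj dP2 t1 t2.
- case: pos {t1 t2 dP2} tc td => tc td; first exact: translates_iff tc.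
  apply: translates_iff td => x y; rewrite /polar /=.
  by have := dec F1 x y; tauto.
- case: pos {t1 t2 dP2} tc td => tc td; first exact: translates_iff td.
  by apply: translates_iff tc => x y; rewrite /polar /=; tauto.
- apply: translates_iff (IH1 (~~ pos) m m0m) => x y; rewrite /polar /=.
  by have := dec F1 x y; case: pos => /=; tauto.
Qed.

Definition translation (phi : sigma2 A) : sigma2 A :=
  let: Sigma2 n m F := phi in
  let: (m', U, V) := tr F false m in
  Sigma2 (WNot (WEq (map (unraw a n m') U) (map (unraw a n m') V))).

Definition extend n (x : 'I_n -> seq A) (i : nat) : seq A :=
  oapp x [::] (insub i).

Lemma extendE n (x : 'I_n -> seq A) : extend x \o @nat_of_ord n =1 x.
Proof. by move=> i; rewrite /extend /= valK. Qed.

(** The same [x] witnesses both sentences: by soundness a solution of [U = V] would refute [F], and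
    by completeness a failure of [F] at some [y] would extend to a solution. *)
Lemma holds_translation phi : holds phi <-> holds (translation phi).
Proof.
case: phi => n m F /=; have := tr_translates F false (leqnn m).
case: (tr F false m) => [[m' U] V] [/= _ /andP[/= Ub Vb] sound complete].
have valE x y w : all (rsym_below n m') w ->
    word_val (x \o @nat_of_ord n) (y \o @nat_of_ord m') (map (unraw a n m') w) =
    rval x y w.
  by move=> wb; rewrite -rval_raw unrawK.
split=> -[x hx]; exists x => y.
  rewrite -!(word_val_ext _ (extendE x) (extendE y)) !valE // => /sound.
  by apply; apply/(sat_ext F (extendE x) (fun=> erefl))/hx.
have [//|nF] := sat_dec x y F.
have [|y' _] := complete (extend x) (extend y).
  by rewrite /polar (sat_ext F (extendE x) (extendE y)).
rewrite /rholds /= -!valE // !(word_val_ext _ (extendE x) (fun=> erefl)).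
by move=> eqUV; case: (hx (y' \o @nat_of_ord m')).
Qed.

End Translation.

(** * Evaluation in the lambda calculus *)

Definition is_lam (s : term) : bool := if s is Lam _ then true else false.
Definition closed_value (s : term) : bool := closed_term s && is_lam s.

Lemma bounded_leq k l s : k <= l -> bounded k s -> bounded l s.
Proof.
elim: s k l => [i|s1 IH1 s2 IH2|s IH] k l kl /=; first by move/leq_trans; apply.
  by move=> /andP[/(IH1 _ _ kl) -> /(IH2 _ _ kl) ->].
exact: IH.
Qed.

Lemma subst_bounded k l s u : k <= l -> bounded k s -> subst s l u = s.
Proof.
elim: s k l => [i|s1 IH1 s2 IH2|s IH] k l kl /=.
- by case: eqP => // ->; rewrite ltnNge kl.
- by move=> /andP[/(IH1 _ _ kl) -> /(IH2 _ _ kl) ->].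
- by move=> /(IH k.+1 l.+1 kl) ->.
Qed.

Lemma subst_closed s k u : closed_value s -> subst s k u = s.
Proof. by case/andP => /subst_bounded-> //. Qed.

Lemma closed_value_bounded s k : closed_value s -> bounded k s.
Proof. by case/andP => /bounded_leq-> //. Qed.

Lemma evaluates_lam s : is_lam s -> evaluates s s.
Proof. by case: s => // s _; constructor. Qed.

(** Stated through final values, this allows stepwise reasoning by transitivity and congruence on
    top of the big-step semantics. *)
Definition reduces (s t : term) := forall v, evaluates t v -> evaluates s v.

Lemma reduces_refl s : reduces s s.
Proof. by []. Qed.

Lemma reduces_trans s t u : reduces s t -> reduces t u -> reduces s u.
Proof. by move=> st tu v /tu/st. Qed.

Lemma reduces_app s s' t t' :
  reduces s s' -> reduces t t' -> reduces (App s t) (App s' t').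
Proof.
move=> ss' tt' v ev; inversion ev; subst.
by apply: eval_app; [apply: ss' | apply: tt' |]; eassumption.
Qed.

Lemma reduces_beta s t : is_lam t -> reduces (App (Lam s) t) (subst s 0 t).
Proof.
by move=> /evaluates_lam vt v; apply: eval_app vt => //; constructor.
Qed.

Lemma reduces_beta_closed s t :
  closed_value t -> reduces (App (Lam s) t) (subst s 0 t).
Proof. by case/andP=> _ /reduces_beta. Qed.

Lemma closed_value_scott k i (args : seq term) :
  i < k -> all closed_value args -> closed_value (scott k i args).
Proof.
move=> ik argsP; rewrite /scott /closed_value.
have bd : bounded k (foldl App (Var (k - i.+1)) args).
  have : bounded k (Var (k - i.+1)) by rewrite /=; lia.
  elim: args (Var _) argsP => //= t args IH s /andP[tP argsP] sb.
  by apply: IH => //=; rewrite sb closed_value_bounded.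
have lam_bounded j l s : bounded (j + l) s -> bounded l (iter j Lam s).
  by elim: j l => //= j IH l; rewrite addSnnS => /IH.
rewrite /closed_term lam_bounded ?addn0 //=.
by case: k ik {bd}.
Qed.

Lemma closed_nat n : closed_value (enc_nat n).
Proof. by elim: n => // n IH; apply: closed_value_scott; rewrite //= IH. Qed.

Lemma closed_seq (X : Type) (enc : X -> term) (s : seq X) :
  (forall x, closed_value (enc x)) -> closed_value (enc_seq enc s).
Proof.
move=> encP; elim: s => // x s IH.
by apply: closed_value_scott; rewrite //= encP IH.
Qed.

Definition enc_bool (b : bool) : term := scott 2 (~~ b) [::].

Lemma closed_bool b : closed_value (enc_bool b).
Proof. by case: b. Qed.

Lemma bounded_subst k s u :
  bounded k.+1 s -> closed_value u -> bounded k (subst s k u).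
Proof.
move=> + uP; elim: s k => [i|s1 IH1 s2 IH2|s IH] k /=.
- by case: eqP => [_ _|]; [apply: closed_value_bounded | rewrite /=; lia].
- by move=> /andP[/IH1 -> /IH2 ->].
- exact: IH.
Qed.

(* Recursion by self-application: r is passed to itself at each call.           *)
Lemma recursion_program s : bounded 2 s ->
  exists r, [/\ closed_value r, closed_value (subst (Lam s) 0 r) &
    reduces (App r r) (subst (Lam s) 0 r)].
Proof.
move=> sb; have rP : closed_value (Lam (Lam s)).
  by rewrite /closed_value /closed_term /= sb.
exists (Lam (Lam s)); split=> //; last exact: reduces_beta_closed.
by rewrite /closed_value andbT; apply: bounded_subst rP.
Qed.

Section Encodings.
Variable A : finType.

Definition enc_rsym (s : rsym A) : term :=
  match s with
  | RCst c => scott 3 0 [:: enc_nat (enum_rank c)]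
  | REx i => scott 3 1 [:: enc_nat i]
  | RAll j => scott 3 2 [:: enc_nat j]
  end.

Definition enc_rword : seq (rsym A) -> term := enc_seq enc_rsym.

Lemma closed_rsym s : closed_value (enc_rsym s).
Proof. by case: s => i; apply: closed_value_scott; rewrite //= closed_nat. Qed.

Lemma closed_rword w : closed_value (enc_rword w).
Proof. exact/closed_seq/closed_rsym. Qed.

Lemma enc_word_raw n m (w : word A n m) :
  enc_word w = enc_rword (map (@raw A n m) w).
Proof.
by elim: w => //= s w; rewrite /enc_word /enc_rword /= => ->; case: s.
Qed.

Lemma closed_word n m (w : word A n m) : closed_value (enc_word w).
Proof. by rewrite enc_word_raw closed_rword. Qed.

Lemma closed_qf n m (F : qf_formula A n m) : closed_value (enc_qf F).
Proof.
elim: F => [U V|F1 IH1 F2 IH2|F1 IH1 F2 IH2|F1 IH1];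
  by apply: closed_value_scott; rewrite //= ?closed_word ?IH1 ?IH2.
Qed.

Definition enc_requation (E : requation A) : term :=
  scott 1 0 [:: enc_nat E.1.1; enc_rword E.1.2; enc_rword E.2].

Lemma closed_requation E : closed_value (enc_requation E).
Proof. by apply: closed_value_scott; rewrite //= closed_nat !closed_rword. Qed.

End Encodings.

Create HintDb closed_values.
#[local] Hint Resolve closed_nat closed_seq closed_bool closed_rsym closed_rword
  closed_word closed_qf closed_requation : closed_values.
#[local] Hint Extern 0 (is_true (is_lam (Lam _))) => exact isT : closed_values.

Ltac closed := solve [auto with closed_values].

Ltac subst_simpl :=
  cbn [subst eqn eqtype.eq_op]; rewrite /=;
  repeat match goal with
  | |- context [subst ?s ?k ?u] => rewrite (@subst_closed s k u); last closed
  end.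

(* One call-by-value step, where [lems] solves the steps of known programs.     *)
Ltac step lems :=
  lazymatch goal with
  | |- reduces (App ?f ?x) _ =>
      first
        [ eapply reduces_trans; [solve [lems] |]
        | eapply reduces_trans;
          [eapply reduces_app;
            [step lems; apply: reduces_refl | apply: reduces_refl] |]
        | eapply reduces_trans;
          [eapply reduces_app;
            [apply: reduces_refl | step lems; apply: reduces_refl] |]
        | eapply reduces_trans;
          [first [ apply: reduces_beta; exact isT
                 | apply: reduces_beta_closed; closed ] |];
          subst_simpl ]
  end.

(** * Lambda terms computing the translation *)

Section Programs.
Variable A : finType.

Lemma cons_program : exists2 t, closed_value t &
  forall u v, closed_value u -> closed_value v ->
    reduces (App (App t u) v) (scott 2 1 [:: u; v]).
Proof.
(* The two binders of the constructor shift the arguments [Var 1] and [Var 0] by two. *)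
exists (Lam (Lam (scott 2 1 [:: Var 3; Var 2]))) => // u v uP vP.
do 2!step fail. apply: reduces_refl.
Qed.

(** As [k] is fixed, [k] nested successors suffice. Each is a redex, so that its argument is
    evaluated before it goes under the binders of the constructor. *)
Lemma add_program k : exists2 t, closed_value t &
  forall n, reduces (App t (enc_nat n)) (enc_nat (n + k)).
Proof.
elim: k => [|k [t tP tE]].
  by exists (Lam (Var 0)) => // n; step fail; rewrite addn0; apply: reduces_refl.
exists (Lam (App (Lam (scott 2 1 [:: Var 2])) (App t (Var 0)))).
  by rewrite /closed_value /closed_term /= closed_value_bounded.
move=> n; step fail; step ltac:(apply: tE); step fail; rewrite addnS.
exact: reduces_refl.
Qed.

Lemma fresh_program k : exists2 t, closed_value t &
  forall n, reduces (App t (enc_nat n)) (enc_rsym (RAll (n + k) : rsym A)).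
Proof.
have [t tP tE] := add_program k.
exists (Lam (App (Lam (scott 3 2 [:: Var 3])) (App t (Var 0)))).
  by rewrite /closed_value /closed_term /= closed_value_bounded.
move=> n; step fail; step ltac:(apply: tE); step fail; apply: reduces_refl.
Qed.

Lemma requation_program : exists2 t, closed_value t &
  forall m (U V : seq (rsym A)),
    reduces (App (App (App t (enc_nat m)) (enc_rword U)) (enc_rword V))
            (enc_requation (m, U, V)).
Proof.
exists (Lam (Lam (Lam (scott 1 0 [:: Var 3; Var 2; Var 1])))) => // m U V.
do 3!step fail; apply: reduces_refl.
Qed.

Lemma cat_program : exists2 t, closed_value t &
  forall U V : seq (rsym A),
    reduces (App (App t (enc_rword U)) (enc_rword V)) (enc_rword (U ++ V)).
Proof.
have [c cP consE] := cons_program.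
(* A Scott list is its own case analysis: the empty word returns [V], and a nonempty one conses its
   head to the recursive call on its tail. *)
pose body := Lam (App (App (Var 1) (Var 0)) (Lam (Lam
  (App (App c (Var 1)) (App (App (App (Var 4) (Var 4)) (Var 0)) (Var 2)))))).
have [|r [rP fP rE]] := @recursion_program body.
  by rewrite /= !(closed_value_bounded _ cP).
exists (subst (Lam body) 0 r) => // U V; elim: U => [|s U IH].
  rewrite /=; subst_simpl. do 4!step fail; apply: reduces_refl.
rewrite {1}/body /=; subst_simpl.
do 6!step fail.
step ltac:(apply: rE). step ltac:(apply: IH).
step ltac:(apply: consE; closed).
apply: reduces_refl.
Qed.

(* t is a context with holes p for the parameters and n for the first fresh     *)
(* variable.                                                                    *)
Lemma fill_program L : exists t : seq term -> term -> term,
  [/\ forall p n k, all (bounded k) p -> bounded k n -> bounded k (t p n),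
      forall p n k u,
        subst (t p n) k u = t (map (fun s => subst s k u) p) (subst n k u) &
      forall ws m, reduces (t (map (@enc_rword A) ws) (enc_nat m))
                           (enc_rword (instance ws m L))].
Proof.
have [cons consP consE] := cons_program; have [cat catP catE] := cat_program.
pose nilw := enc_rword ([::] : seq (rsym A)).
have nilP : closed_value nilw := closed_rword _.
elim: L => [|s L [t [tb ts tE]]].
  exists (fun _ _ => nilw); split=> [*|*|*]; last exact: reduces_refl.
    exact: closed_value_bounded.
  exact: subst_closed.
case: s => [i|c|j].
- exists (fun p n => App (App cat (nth nilw p i)) (t p n)); split.
  + move=> p n k pP nP; rewrite /= tb // andbT closed_value_bounded //=.
    have [?|?] := leqP (size p) i; last exact: all_nthP.
    by rewrite nth_default // closed_value_bounded.
  + move=> p n k u; rewrite /= ts (subst_closed _ _ catP).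
    congr (App (App _ _) _).
    have [?|?] := leqP (size p) i; last by rewrite (nth_map nilw).
    by rewrite !nth_default ?size_map // subst_closed.
  + move=> ws m; apply: reduces_trans (catE _ _).
    apply: reduces_app (tE _ _); apply: reduces_app; first exact: reduces_refl.
    have [?|?] := leqP (size ws) i; last by rewrite (nth_map [::]).
    by rewrite /fill !nth_default ?size_map.
- have [letter letterP letterE] : exists2 t, closed_value t &
      t = enc_rsym (RCst c : rsym A).
    by exists (enc_rsym (RCst c)); rewrite ?closed_rsym.
  exists (fun p n => App (App cons letter) (t p n)); split.
  + by move=> p n k pP nP; rewrite /= tb // !closed_value_bounded.
  + move=> p n k u.
    by rewrite /= ts (subst_closed _ _ consP) (subst_closed _ _ letterP).
  + move=> ws m.
    have := consE letter _ letterP (closed_rword (instance ws m L)).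
    rewrite {2}letterE; apply: reduces_trans.
    by apply: reduces_app (tE _ _); apply: reduces_refl.
- have [fresh freshP freshE] := fresh_program j.
  exists (fun p n => App (App cons (App fresh n)) (t p n)); split.
  + by move=> p n k pP nP; rewrite /= tb // nP !closed_value_bounded.
  + move=> p n k u.
    by rewrite /= ts (subst_closed _ _ consP) (subst_closed _ _ freshP).
  + move=> ws m.
    have := consE _ _ (closed_rsym (RAll (m + j) : rsym A))
                      (closed_rword (instance ws m L)).
    apply: reduces_trans; apply: reduces_app (tE _ _).
    by apply: reduces_app (freshE _); apply: reduces_refl.
Qed.

Lemma build_program (g : gadget A) : exists2 t, closed_value t &
  forall U V U' V' m,
    reduces (App (App (App (App (App t (enc_rword U)) (enc_rword V))
                                (enc_rword U')) (enc_rword V')) (enc_nat m))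
            (enc_requation (build g U V U' V' m)).
Proof.
have [req reqP reqE] := requation_program.
have [add addP addE] := add_program g.1.
have [l [lb ls lE]] := fill_program g.2.1.
have [r [rb rs rE]] := fill_program g.2.2.
pose p := [:: Var 4; Var 3; Var 2; Var 1].
exists (Lam (Lam (Lam (Lam (Lam
  (App (App (App req (App add (Var 0))) (l p (Var 0))) (r p (Var 0)))))))).
  by rewrite /closed_value /closed_term /= (closed_value_bounded _ reqP)
    (closed_value_bounded _ addP) lb ?rb.
move=> U V U' V' m; do 5!step fail; rewrite !(ls, rs) /=; subst_simpl.
apply: reduces_trans (reqE _ _ _).
apply: reduces_app (rE [:: U; V; U'; V'] m).
apply: reduces_app (lE [:: U; V; U'; V'] m).
apply: reduces_app (addE m); exact: reduces_refl.
Qed.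

(** One term serves all [n] and [m0], since [enc_qf] does not record them. The polarity, being a
    Scott boolean, selects between two gadget programs, and each recursive result is unpacked by a
    three-argument continuation. *)
Lemma tr_program (a b : A) : exists2 t, closed_value t &
  forall n m0 (F : qf_formula A n m0) pos m,
    reduces (App (App (App t (enc_qf F)) (enc_bool pos)) (enc_nat m))
            (enc_requation (tr a b F pos m)).
Proof.
have [eqt eqtP eqtE] := build_program (gatom A).
have [neqt neqtP neqtE] := build_program (gneq a b).
have [conjt conjtP conjtE] := build_program (gconj a b).
have [disjt disjtP disjtE] := build_program (gdisj a b).
(* In scope: r, F, b, m as Var 3, 2, 1, 0, shifted by the inner binders.        *)
pose atom := Lam (Lam (App (App (App (App (App (App (App (Var 3) eqt) neqt)
  (Var 1)) (Var 0)) (Var 1)) (Var 0)) (Var 2))).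
pose binary g g' := Lam (Lam (App
  (App (App (App (App (Var 5) (Var 5)) (Var 1)) (Var 3)) (Var 2))
  (Lam (Lam (Lam (App
    (App (App (App (App (Var 8) (Var 8)) (Var 3)) (Var 6)) (Var 2))
    (Lam (Lam (Lam
      (App (App (App (App (App (App (App (Var 9) g) g')
        (Var 4)) (Var 3)) (Var 1)) (Var 0)) (Var 2))))))))))).
pose neg := Lam (App
  (Lam (App (App (App (App (Var 5) (Var 5)) (Var 1)) (Var 0)) (Var 2)))
  (App (App (Var 2) (enc_bool false)) (enc_bool true))).
pose body := Lam (Lam (App (App (App (App (Var 2) atom) (binary conjt disjt))
  (binary disjt conjt)) neg)).
have [|r [rP fP rE]] := @recursion_program body.
  by rewrite /= !closed_value_bounded.
exists (subst (Lam body) 0 r) => // n m0 F.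
rewrite /body /atom /binary /neg /= in fP rE *.
rewrite ?(subst_closed _ _ eqtP, subst_closed _ _ neqtP, subst_closed _ _ conjtP,
  subst_closed _ _ disjtP) in fP rE *.
elim: F => [U V|F1 IH1 F2 IH2|F1 IH1 F2 IH2|F1 IH1] pos m.
- have eqtW := eqtE (map (@raw A n m0) U) (map (@raw A n m0) V)
                      (map (@raw A n m0) U) (map (@raw A n m0) V) m.
  have neqtW := neqtE (map (@raw A n m0) U) (map (@raw A n m0) V)
                      (map (@raw A n m0) U) (map (@raw A n m0) V) m.
  rewrite -!enc_word_raw in eqtW neqtW.
  case: pos => /=; repeat step ltac:(first [apply: eqtW | apply: neqtW]);
    exact: reduces_refl.
1,2: rewrite [tr _ _ _ _ _]/=; have := IH1 pos m;
  case: (tr a b F1 pos m) => [[m1 U1] V1] tr1; have := IH2 pos m1;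
  case: (tr a b F2 pos m1) => [[m2 U2] V2] tr2; case: pos tr1 tr2 => tr1 tr2;
  repeat step ltac:(first [apply: rE | apply: tr1 | apply: tr2
                          | apply: conjtE | apply: disjtE]);
  exact: reduces_refl.
by have := IH1 (~~ pos) m; case: pos => tr1;
  repeat step ltac:(first [apply: rE | apply: tr1]); apply: reduces_refl.
Qed.

Lemma translation_computable (a b : A) : a != b ->
  computable (@enc_sigma2 A) (@enc_sigma2 A) (translation a b).
Proof.
move=> ab; have [t tP tE] := tr_program a b.
exists (Lam (App (Var 0) (Lam (Lam (Lam (App
  (App (App (App t (Var 0)) (enc_bool false)) (Var 1))
  (Lam (Lam (Lam (scott 1 0
    [:: Var 6; Var 3; scott 4 3 [:: scott 4 0 [:: Var 10; Var 9]]])))))))))).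
split; first by rewrite /closed_term /= (closed_value_bounded _ tP).
case=> n m F; rewrite [translation _ _ _]/=.
have := tE n m F false m; have := tr_translates ab F false (leqnn m).
case: (tr a b F false m) => [[m' U] V] [_ /andP[Ub Vb] _ _] trE.
apply: (_ : reduces _ _) (evaluates_lam _) => //.
(* Returning to bounded symbols takes no computation: the encoding sees a word only through [raw],
   which cancels [unraw]. *)
rewrite [X in reduces _ X]/= !enc_word_raw !unrawK //.
repeat step ltac:(apply: trE).
exact: reduces_refl.
Qed.

End Programs.

Theorem theorem3p5 (A : finType) (hA : 1 < #|A|) :
  exists T : sigma2 A -> sigma2 A,
    computable (@enc_sigma2 A) (@enc_sigma2 A) T /\
    forall phi : sigma2 A,
      (exists (n m : nat) (U V : word A n m),
          T phi = @Sigma2 A n m (WNot (WEq U V))) /\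
      (holds phi <-> holds (T phi)).
Proof.
have /card_gt1P[a [b [_ _ ab]]] := hA.
exists (translation a b); split; first exact: translation_computable.
move=> phi; split; last exact: holds_translation.
case: phi => n m F /=; case: (tr a b F false m) => [[m' U] V].
by exists n, m', (map (unraw a n m') U), (map (unraw a n m') V).
Qed.
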